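(* Let $k\ge1$ and let $G,H$ be simple graphs with $|V(G)|=|V(H)|$. Then $G$ and $H$ are algebraically $k$-equivalent if and only if there is a level-$k$ quantum isomorphism map from $G$ to $H$.
   Context: Homomorphism tensors: for a $(k,k)$-bilabelled graph $\boldsymbol F=(F,\boldsymbol u,\boldsymbol v)$, $\boldsymbol F_G\in\mathbb C^{V(G)^k\times V(G)^k}$ has $(\boldsymbol x,\boldsymbol y)$-entry the number of homomorphisms $h:F\to G$ with $h(u_i)=x_i,h(v_i)=y_i$. Bilabelled minors: via edge contraction, edge deletion, deletion of unlabelled vertices. $\boldsymbol C_k$: vertices $[2k]$, in-labels $(1,\dots,k)$, out-labels $(k+1,\dots,2k)$, edges $\{i,i+1\}$ ($i\in[2k]\setminus\{k,2k\}$), $\{1,k+1\},\{k,2k\}$; $\boldsymbol M_k$: same vertices/labels, edges $\{i,i+k\}$. $\mathcal Q_k^P,\mathcal Q_k^S$ = bilabelled minors of $\boldsymbol C_k,\boldsymbol M_k$; $\mathcal Q_k$ their union. For $\sigma\in\mathfrak S_{2k}$, $(X^\sigma)_{\boldsymbol z}=X_{\boldsymbol w}$ with $w_{\sigma(i)}=z_i$ (index pairs viewed as $2k$-tuples). $\mathscr C_k$ = cyclic group of rotations of the cyclic sequence $(1,\dots,k,2k,\dots,k+1)$. $I$ identity, $J$ all-ones, $\odot$ entrywise product. Level-$k$ quantum isomorphism map from $G$ to $H$: linear $\Phi:\mathbb{C}^{V(G)^k\times V(G)^k}\to\mathbb{C}^{V(H)^k\times V(H)^k}$, completely positive, with $\Phi(\boldsymbol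 F_G\odot X)=\boldsymbol F_H\odot\Phi(X)$ for $\boldsymbol F\in\mathcal Q_k^P$, $\Phi(I)=I=\Phi^*(I)$, $\Phi(J)=J=\Phi^*(J)$ ($\Phi^*$ trace-inner-product adjoint), $\Phi(\boldsymbol F_G)=\boldsymbol F_H$ for $\boldsymbol F\in\mathcal Q_k$, $\Phi(X^\sigma)=\Phi(X)^\sigma$ for $\sigma\in\mathscr C_k$. Algebraic $k$-equivalence: $\widehat{\mathcal Q}^k_G$ is the smallest subalgebra of $\mathbb C^{V(G)^k\times V(G)^k}$ containing $I,J$, closed under conjugate transpose, under $X\mapsto\boldsymbol F_G\odot X$ for $\boldsymbol F\in\mathcal Q_k^P$, under $X\mapsto X^\sigma$ for $\sigma\in\mathscr C_k$, and containing $\boldsymbol F_G$ for all $\boldsymbol F\in\mathcal Q_k$. $G,H$ are algebraically $k$-equivalent if there is a vector space isomorphism $\varphi:\widehat{\mathcal Q}^k_G\to\widehat{\mathcal Q}^k_H$ with, for all $M,N$: $\varphi(M^* )=\varphi(M)^*$, $\varphi(MN)=\varphi(M)\varphi(N)$, $\varphi(\boldsymbol F_G\odot M)=\boldsymbol F_H\odot\varphi(M)$ ($\boldsymbol F\in\mathcal Q_k^P$), $\varphi(I)=I$, $\varphi(J)=J$, $\varphi(\boldsymbol F_G)=\boldsymbol F_H$ ($\boldsymbol F\in\mathcal Q_k$), $\varphi(M^\sigma)=\varphi(M)^\sigma$ ($\sigma\in\mathscr C_k$), and $\mathrm{tr}\,\varphi(M)=\mathrm{tr}\,M$. *)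

(* Defs.v *)
From mathcomp Require Import all_boot all_algebra all_fingroup.
From mathcomp Require Import reals Rstruct complex.
Set Implicit Arguments.
Unset Strict Implicit.
Unset Printing Implicit Defensive.
Import GRing.Theory Num.Theory.
Local Open Scope ring_scope.

Definition CC : numClosedFieldType := Rdefinitions.R[i].

Definition tup (V : finType) (k : nat) : finType := {ffun 'I_k -> V}.

Definition Mat (V : finType) (k : nat) := tup V k -> tup V k -> CC.

Section MatOps.
Variables (V : finType) (k : nat).
Implicit Types (X Y : Mat V k).

Definition mx_id : Mat V k := fun x y => (x == y)%:R.
Definition mx_J : Mat V k := fun _ _ => 1.
Definition mx_add X Y : Mat V k := fun x y => X x y + Y x y.
Definition mx_scale (a : CC) X : Mat V k := fun x y => a * X x y.
Definition mx_mul X Y : Mat V k := fun x y => \sum_(z : tup V k) X x z * Y z y.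
Definition mx_adj X : Mat V k := fun x y => conjc (X y x).
Definition mx_had X Y : Mat V k := fun x y => X x y * Y x y.
Definition mx_tr X : CC := \sum_(x : tup V k) X x x.
(* trace inner product <A,B> = tr(A^* B) *)
Definition tr_inner X Y : CC :=
  \sum_(x : tup V k) \sum_(y : tup V k) conjc (X x y) * Y x y.
Definition mx_unit (x y : tup V k) : Mat V k :=
  fun x' y' => ((x' == x) && (y' == y))%:R.

Definition join2 (x y : tup V k) (i : 'I_(k + k)) : V :=
  match split i with inl a => x a | inr b => y b end.

(* (X^σ)_z = X_w  where  w_{σ(i)} = z_i,  i.e. w_j = z_{σ^{-1}(j)} *)
Definition mx_perm (s : {perm 'I_(k + k)}) X : Mat V k :=
  fun x y =>
    X [ffun i => join2 x y ((s^-1)%g (lshift k i))]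
      [ffun i => join2 x y ((s^-1)%g (rshift k i))].
End MatOps.
Arguments mx_id V k : clear implicits.
Arguments mx_J V k : clear implicits.

Definition psd (S : finType) (Y : S -> S -> CC) : Prop :=
  forall v : S -> CC, 0 <= \sum_(p : S) \sum_(q : S) conjc (v p) * Y p q * v q.

Definition is_linear (V W : finType) (k : nat) (Phi : Mat V k -> Mat W k) :=
  forall (a : CC) (X Y : Mat V k),
    Phi (mx_add (mx_scale a X) Y) = mx_add (mx_scale a (Phi X)) (Phi Y).

(* Phi is completely positive: id_n ⊗ Phi maps PSD matrices to PSD
   matrices for every n (block matrices indexed by 'I_n * V^k). *)
Definition completely_positive (V W : finType) (k : nat)
    (Phi : Mat V k -> Mat W k) : Prop :=
  forall (n : nat) (Y : ('I_n * tup V k)%type -> ('I_n * tup V k)%type -> CC),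
    psd Y ->
    psd (fun (p q : ('I_n * tup W k)%type) =>
           Phi (fun x y => Y (p.1, x) (q.1, y)) p.2 q.2).

(* The adjoint of Phi w.r.t. the trace inner product:
   <X, Phi^*(Y)> = <Phi(X), Y>;  entrywise Phi^*(Y)_{xy} = <Phi(E_{xy}), Y>. *)
Definition lin_adjoint (V W : finType) (k : nat) (Phi : Mat V k -> Mat W k)
    : Mat W k -> Mat V k :=
  fun Y x y => tr_inner (Phi (mx_unit x y)) Y.

Local Close Scope ring_scope.
Record bgraph (k : nat) := BGraph {
  bn : nat;
  badj : rel 'I_bn;
  bin : 'I_k -> 'I_bn;
  bout : 'I_k -> 'I_bn }.
Arguments bn {k} b.
Arguments badj {k} b _ _.
Arguments bin {k} b _.
Arguments bout {k} b _.

Definition homtensor (k : nat) (F : bgraph k) (V : finType) (e : rel V)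
    : Mat V k :=
  fun x y => ((#|[set h : {ffun 'I_(bn F) -> V} |
        [forall a, forall b, badj F a b ==> e (h a) (h b)] &&
        [forall i, (h (bin F i) == x i) && (h (bout F i) == y i)]]|)%:R)%R.

(* One minor step (bilabelled graphs are taken up to isomorphism, i.e.
   up to renumbering of the vertices). *)
Inductive minor_step (k : nat) : bgraph k -> bgraph k -> Prop :=
  | MS_edge_del (n : nat) (E : rel 'I_n) (u v : 'I_k -> 'I_n) (a b : 'I_n) :
      E a b ->
      minor_step (BGraph E u v)
        (BGraph (fun x y => E x y &&
                   ~~ (((x == a) && (y == b)) || ((x == b) && (y == a)))) u v)
  | MS_vertex_del (n m : nat) (E : rel 'I_n) (u v : 'I_k -> 'I_n)
      (w : 'I_n) (f : 'I_m -> 'I_n) (E' : rel 'I_m) (u' v' : 'I_k -> 'I_m) :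
      injective f ->
      (forall z, (z != w) = (z \in codom f)) ->
      (forall i, u i != w) -> (forall i, v i != w) ->
      (forall x y, E' x y = E (f x) (f y)) ->
      (forall i, f (u' i) = u i) -> (forall i, f (v' i) = v i) ->
      minor_step (BGraph E u v) (BGraph E' u' v')
  | MS_contract (n m : nat) (E : rel 'I_n) (u v : 'I_k -> 'I_n)
      (a b : 'I_n) (g : 'I_n -> 'I_m) (E' : rel 'I_m) :
      E a b ->
      (forall p, p \in codom g) ->
      (forall x y, (g x == g y) =
          [|| x == y, (x == a) && (y == b) | (x == b) && (y == a)]) ->
      (forall p q, E' p q =
          (p != q) && [exists x, exists y, [&& g x == p, g y == q & E x y]]) ->
      minor_step (BGraph E u v) (BGraph E' (fun i => g (u i)) (fun i => g (v i))).

Inductive bminor (k : nat) (F : bgraph k) : bgraph k -> Prop :=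
  | BM_refl : bminor F F
  | BM_step (F1 F2 : bgraph k) : bminor F F1 -> minor_step F1 F2 -> bminor F F2.

(* C_k and M_k on vertices 'I_(k+k) (0-indexed: vertex i+1 of the paper
   is i here); in-labels 0..k-1, out-labels k..2k-1. *)
Definition Ck_edge (k : nat) (a b : nat) : bool :=
  [|| (b == a.+1) && (a.+1 != k), (a == 0%N) && (b == k)
    | (a == k.-1) && (b == (k + k).-1)].
Definition Ck_adj (k : nat) : rel 'I_(k + k) :=
  fun a b => Ck_edge k a b || Ck_edge k b a.
Arguments Ck_adj k : clear implicits.
Definition Cbg (k : nat) : bgraph k :=
  BGraph (Ck_adj k) (fun i : 'I_k => lshift k i) (fun i : 'I_k => rshift k i).

Definition Mk_adj (k : nat) : rel 'I_(k + k) :=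
  fun a b => (val b == (val a + k)%N) || (val a == (val b + k)%N).
Arguments Mk_adj k : clear implicits.
Definition Mbg (k : nat) : bgraph k :=
  BGraph (Mk_adj k) (fun i : 'I_k => lshift k i) (fun i : 'I_k => rshift k i).

Definition QP (k : nat) (F : bgraph k) : Prop := bminor (Cbg k) F.
Definition QS (k : nat) (F : bgraph k) : Prop := bminor (Mbg k) F.
Definition Qk (k : nat) (F : bgraph k) : Prop := QP F \/ QS F.

(* The cyclic group 𝒞_k of rotations of the cyclic sequence
   (1,...,k,2k,...,k+1); 0-indexed the sequence is s_j = j for j<k and
   s_j = 3k-1-j for k <= j < 2k.  σ is in 𝒞_k iff it is a rotation:
   σ(s_j) = s_{j+r mod 2k} for some r. *)
Definition cycseq (k j : nat) : nat := if (j < k)%N then j else (3 * k).-1 - j.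
Definition in_cyc (k : nat) (s : {perm 'I_(k + k)}) : Prop :=
  exists r : nat, forall (i : 'I_(k + k)) (j : nat),
    (j < k + k)%N -> val i = cycseq k j ->
    val (s i) = cycseq k ((j + r) %% (k + k)).

Local Open Scope ring_scope.
Definition qiso_map (k : nat) (VG VH : finType) (eG : rel VG) (eH : rel VH)
    (Phi : Mat VG k -> Mat VH k) : Prop :=
  (is_linear Phi)
   /\ (completely_positive Phi)
   /\ ((forall F X, QP F -> Phi (mx_had (homtensor F eG) X)
                           = mx_had (homtensor F eH) (Phi X)))
   /\ (Phi (mx_id VG k) = mx_id VH k /\ lin_adjoint Phi (mx_id VH k) = mx_id VG k)
   /\ (Phi (mx_J VG k) = mx_J VH k /\ lin_adjoint Phi (mx_J VH k) = mx_J VG k)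
   /\ ((forall F, Qk F -> Phi (homtensor F eG) = homtensor F eH))
   /\ ((forall s X, in_cyc s -> Phi (mx_perm s X) = mx_perm s (Phi X))).

Inductive qhat (k : nat) (V : finType) (e : rel V) : Mat V k -> Prop :=
  | QH_id : qhat e (mx_id V k)
  | QH_J : qhat e (mx_J V k)
  | QH_add X Y : qhat e X -> qhat e Y -> qhat e (mx_add X Y)
  | QH_scale a X : qhat e X -> qhat e (mx_scale a X)
  | QH_mul X Y : qhat e X -> qhat e Y -> qhat e (mx_mul X Y)
  | QH_adj X : qhat e X -> qhat e (mx_adj X)
  | QH_had F X : QP F -> qhat e X -> qhat e (mx_had (homtensor F e) X)
  | QH_perm s X : in_cyc s -> qhat e X -> qhat e (mx_perm s X)
  | QH_hom F : Qk F -> qhat e (homtensor F e).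

Definition alg_equiv (k : nat) (VG VH : finType) (eG : rel VG) (eH : rel VH)
    : Prop :=
  exists phi : Mat VG k -> Mat VH k,
    (
        (forall X, qhat eG X -> qhat eH (phi X)))
   /\ ((forall a X Y, qhat eG X -> qhat eG Y ->
            phi (mx_add (mx_scale a X) Y) = mx_add (mx_scale a (phi X)) (phi Y)))
   /\ ((forall X Y, qhat eG X -> qhat eG Y -> phi X = phi Y -> X = Y))
   /\ ((forall Y, qhat eH Y -> exists2 X, qhat eG X & phi X = Y))
   /\ ((forall M, qhat eG M -> phi (mx_adj M) = mx_adj (phi M)))
   /\ ((forall M N, qhat eG M -> qhat eG N ->
            phi (mx_mul M N) = mx_mul (phi M) (phi N)))
   /\ ((forall F M, QP F -> qhat eG M ->
            phi (mx_had (homtensor F eG) M) = mx_had (homtensor F eH) (phi M)))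
   /\ (phi (mx_id VG k) = mx_id VH k /\ phi (mx_J VG k) = mx_J VH k)
   /\ ((forall F, Qk F -> phi (homtensor F eG) = homtensor F eH))
   /\ ((forall s M, in_cyc s -> qhat eG M -> phi (mx_perm s M) = mx_perm s (phi M)))
   /\ ((forall M, qhat eG M -> mx_tr (phi M) = mx_tr M)).

(* Main.v *)
(* Both directions turn on the trace inner product <X, Y> = tr(X^* Y).

   From a map Phi to an equivalence: Phi is unital, trace preserving and
   completely positive, so the defect Phi(M^* N) - Phi(M)^* Phi(N) is a positive
   semidefinite kernel. Hence Phi is a contraction, and if it preserves the norm
   of M then Phi(M^* N) = Phi(M)^* Phi(N) for all N. The set of such M (the
   multiplicative domain) is a *-algebra. It contains J and the homomorphism
   tensors, which are 0/1-valued because every vertex of a minor of C_k or M_k is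
   labelled, and it is closed under the Hadamard products and rotations. So it
   contains the whole algebra of G, on which Phi is the required isomorphism.

   From an equivalence phi to a map: take Phi := phi o E with E the orthogonal
   projection onto the algebra of G. Since phi is isometric,
   <phi(Z), Phi(X)> = <Z, X>, which gives the adjoint conditions. For complete
   positivity, let Z be the block matrix of the Phi(Y_ij) with Y positive
   semidefinite. Then tr(d^* Z d) >= 0 for every block matrix d over the algebra
   of H, in particular for polynomials in Z, and this forces Z >= 0. *)
Require Import Defs.
From mathcomp Require Import all_boot all_order all_algebra all_fingroup.
From mathcomp Require Import reals Rstruct complex boolp ring.
Set Implicit Arguments.
Unset Strict Implicit.
Unset Printing Implicit Defensive.
Import Order.TTheory GRing.Theory Num.Theory.
Local Open Scope ring_scope.

(** * Positivity of a matrix tested only inside an algebra containing it *)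

Section PsdSubalgebra.
Local Open Scope sesquilinear_scope.

Lemma gram_trace_gt0 n (d : 'M[CC]_n) : d != 0 -> 0 < \tr (d^t* *m d).
Proof.
move=> dN0; have trE : \tr (d^t* *m d) = \sum_i \sum_j `|d j i| ^+ 2.
  apply: eq_bigr => i _; rewrite mxE; apply: eq_bigr => j _.
  by rewrite !mxE mulrC -normCK.
rewrite trE lt0r sumr_ge0 ?andbT; last first.
  by move=> i _; apply: sumr_ge0 => j _; rewrite exprn_ge0.
apply: contraNneq dN0 => tr0; apply/eqP/matrixP => j i; rewrite mxE.
have := psumr_eq0P (fun i _ => sumr_ge0 _ (fun j _ => exprn_ge0 2 (normr_ge0 (d j i)))) tr0.
move=> /(_ i isT) /psumr_eq0P /(_ j isT) /eqP.
by rewrite sqrf_eq0 normr_eq0 => /(_ (fun j _ => exprn_ge0 2 (normr_ge0 _)))/eqP.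
Qed.

(* If [l] is an eigenvalue and the minimal polynomial is [q * ('X - l)], then
   [d := q(Z)] is nonzero with [Z d = l d], so testing against [d] gives [l >= 0]. *)
Lemma hermitian_eigenvalue_ge0 n (Z : 'M[CC]_n.+1) (l : CC) :
  (forall p : {poly CC}, 0 <= \tr ((horner_mx Z p)^t* *m Z *m horner_mx Z p)) ->
  eigenvalue Z l -> 0 <= l.
Proof.
move=> Zpos; rewrite eigenvalue_root_min => /factor_theorem [q qE].
have pN0 : mxminpoly Z != 0 := monic_neq0 (mxminpoly_monic Z).
have qN0 : q != 0 by apply: contraNneq pN0 => q0; rewrite qE q0 mul0r.
set d := horner_mx Z q.
have dN0 : d != 0.
  rewrite /d -dvd_mxminpoly; apply/negP => /(dvdp_leq qN0).
  by rewrite qE size_Mmonic ?monicXsubC // size_XsubC addn2 ltnn.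
have Zd : Z *m d = l *: d.
  have : horner_mx Z (('X - l%:P) * q) = 0.
    by apply/eqP; rewrite -dvd_mxminpoly qE mulrC dvdpp.
  rewrite rmorphM rmorphB /= horner_mx_X horner_mx_C -mulmxE mulmxBl mul_scalar_mx.
  by move/eqP; rewrite subr_eq0 => /eqP.
move: (Zpos q); rewrite -/d -mulmxA Zd -scalemxAr mxtraceZ.
by rewrite pmulr_lge0 // gram_trace_gt0.
Qed.

(** Diagonalise [Z] by a unitary [P]: the form at [w] becomes the sum of the eigenvalues weighted by
    [|(P w)_i|^2], and the eigenvalues are nonnegative by the previous lemma. *)
Lemma hermitian_quad_ge0 n (Z : 'M[CC]_n.+1) (w : 'cV[CC]_n.+1) :
  Z \is hermsymmx ->
  (forall p : {poly CC}, 0 <= \tr ((horner_mx Z p)^t* *m Z *m horner_mx Z p)) ->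
  0 <= (w^t* *m Z *m w) 0 0.
Proof.
move=> Zherm Zpos.
have /hermitian_normalmx/orthomx_spectralP := Zherm.
set P := spectralmx Z; set D := spectral_diag Z => ZE.
have Pun : P \is unitarymx := spectral_unitarymx Z.
(* Row [i] of [P] is a left eigenvector for [D 0 i]; it is nonzero because the diagonal of [P P^*]
   is 1. *)
have D_ge0 i : 0 <= D 0 i.
  apply: (hermitian_eigenvalue_ge0 Zpos); apply/eigenvalueP.
  exists (row i P).
    rewrite -row_mul ZE !mulmxA mulmxV ?spectral_unit // mul1mx.
    by rewrite row_mul row_diag_mx -scalemxAl -rowE.
  apply/negP => /eqP rP0; have /unitarymxP/matrixP/(_ i i) := Pun.
  rewrite !mxE eqxx big1 => [/eqP|j _]; first by rewrite eq_sym oner_eq0.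
  by have /rowP/(_ j) := rP0; rewrite !mxE => ->; rewrite mul0r.
rewrite ZE invmx_unitary // !mulmxA -map_mxM -trmx_mul -!mulmxA.
rewrite mulmxA mxE; apply: sumr_ge0 => i _.
rewrite mul_mx_diag !mxE mulrAC [_ * (\sum_ _ _)]mulrC.
by rewrite mulr_ge0 ?mul_conjC_ge0.
Qed.

(** The closure conditions put every polynomial in [Z] into [B], and polynomials in [Z] are the only
    test matrices that the eigenvalue argument uses. *)
Lemma psd_of_subalgebra (S : finType) (Z : S -> S -> CC)
    (B : (S -> S -> CC) -> Prop) :
  (forall p q, Z p q = conjc (Z q p)) ->
  B (fun p q => (p == q)%:R) ->
  (forall a d d', B d -> B d' -> B (fun p q => a * d p q + d' p q)) ->
  (forall d d', B d -> B d' -> B (fun p q => \sum_r d p r * d' r q)) ->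
  B Z ->
  (forall d, B d -> 0 <= \sum_r \sum_p \sum_q conjc (d p r) * Z p q * d q r) ->
  psd Z.
Proof.
move=> Zherm B1 BD BM BZ Bpos v.
(* Polynomials are evaluated at matrices of size [n.+1], so the empty index set is treated apart. *)
have [S0|] := posnP #|S|.
  rewrite big1 // => p _; have /card0_eq/(_ p) := S0.
  by rewrite !inE.
case Sn : #|S| => [//|n] _.
pose f (i : 'I_n.+1) : S := enum_val (cast_ord (esym Sn) i).
pose g (s : S) : 'I_n.+1 := cast_ord Sn (enum_rank s).
have fK : cancel f g by move=> i; rewrite /f /g enum_valK cast_ordKV.
have gK : cancel g f by move=> s; rewrite /f /g cast_ordK enum_rankK.
have sumE (F : S -> CC) : \sum_s F s = \sum_i F (f i).
  by rewrite (reindex f) //; exists g => ? _; rewrite ?fK ?gK.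
pose Zm : 'M[CC]_n.+1 := \matrix_(i, j) Z (f i) (f j).
have Bh (p : {poly CC}) : B (fun s t => horner_mx Zm p (g s) (g t)).
  elim/poly_ind: p => [|p c IH].
    (* The zero matrix is obtained as [-1 * 1 + 1], the form that [BD] offers. *)
    have := BD (-1) _ _ B1 B1; congr B.
    apply/funext => s; apply/funext => t.
    by rewrite raddf0 !mxE mulN1r addNr.
  have := BD c _ _ B1 (BM _ _ IH BZ); congr B.
  apply/funext => s; apply/funext => t.
  rewrite rmorphD rmorphM /= horner_mx_X horner_mx_C !mxE addrC sumE.
  rewrite mulr_natr (inj_eq (can_inj gK)); congr (_ + _).
  by apply: eq_bigr => i _; rewrite !mxE fK gK.
have -> : \sum_p \sum_q conjc (v p) * Z p q * v q =
    ((\col_i v (f i))^t* *m Zm *m \col_i v (f i)) 0 0.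
  rewrite sumE mxE exchange_big /= sumE; apply: eq_bigr => j _.
  rewrite !mxE mulr_suml; apply: eq_bigr => i _.
  by rewrite !mxE.
apply: hermitian_quad_ge0.
  apply/is_hermitianmxP; rewrite expr0 scale1r; apply/matrixP => i j.
  by rewrite !mxE Zherm.
move=> p; have := Bpos _ (Bh p).
rewrite sumE; congr (_ <= _); apply: eq_bigr => i _.
rewrite mxE exchange_big /= sumE; apply: eq_bigr => j _.
rewrite !mxE sumE mulr_suml; apply: eq_bigr => l _.
by rewrite !mxE !fK.
Qed.

End PsdSubalgebra.

(** * Orthogonal projection onto a subspace of functions on a finite set *)

(** One Gram-Schmidt step per point of [T]: the members of [P] vanishing at a point [t] form a
    subspace [P'] of codimension at most 1. A member [u] with [u t <> 0], made orthogonal to [P'],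
    supplies the missing direction. *)
Lemma orth_proj_exists (T : finType) (P : (T -> CC) -> Prop) :
  P (fun _ => 0) ->
  (forall a u v, P u -> P v -> P (fun t => a * u t + v t)) ->
  forall X : T -> CC, exists2 A, P A &
    forall Z, P Z -> \sum_t conjc (Z t) * (X t - A t) = 0.
Proof.
move=> P0 PD.
(* The full set is generalised to a set [D] outside which all members of [P] vanish; the induction
   is on its size. *)
have : forall u t, P u -> t \notin [set: T] -> u t = 0.
  by move=> u t; rewrite inE.
move: [set: T] => D; move eqm : #|D| => m.
elim: m D eqm P P0 PD => [|m IH] D Dm P P0 PD PS X.
  exists (fun _ => 0) => // Z PZ; rewrite big1 // => t _.
  by rewrite (PS Z t PZ) ?conjc0 ?mul0r // (cards0_eq Dm) inE.
have [t tD] : exists t, t \in D by apply/set0Pn; rewrite -card_gt0 Dm.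
have D'm : #|D :\ t| = m by move: Dm; rewrite (cardsD1 t) tD => -[].
have [[u [Pu ut]]|noU] := pselect (exists u, P u /\ u t <> 0); last first.
  apply: (IH _ D'm) => // u s Pu; rewrite !inE negb_and negbK => /orP[/eqP->|].
    by apply: contrapT => us; apply: noU; exists u.
  exact: PS.
pose P' w := P w /\ w t = 0.
have P'proj : forall X : T -> CC, exists2 A, P' A &
    forall Z, P' Z -> \sum_t conjc (Z t) * (X t - A t) = 0.
  apply: (IH _ D'm) => //.
    by move=> a v w [Pv vt] [Pw wt]; split; [exact: PD|rewrite vt wt mulr0 addr0].
  move=> v s [Pv vt]; rewrite !inE negb_and negbK => /orP[/eqP->//|].
  exact: PS.
have [B [PB Bt] Borth] := P'proj u.
have [u' u'E] : exists u', forall s, u' s = u s - B s by exists (fun s => u s - B s).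
have Pu' : P u'.
  have := PD (-1) _ _ PB Pu; congr P; apply/funext => s.
  by rewrite mulN1r addrC u'E.
have u't : u' t = u t by rewrite u'E Bt subr0.
have [A' [PA' A't] A'orth] := P'proj X.
pose N := \sum_s conjc (u' s) * u' s.
have N0 : N != 0.
  have N_ge0 s : true -> 0 <= conjc (u' s) * u' s.
    by move=> _; rewrite mulrC mul_conjC_ge0.
  apply/eqP => /(psumr_eq0P N_ge0) /(_ t isT) /eqP.
  rewrite mulf_eq0 conjc_eq0 orbb u't => /eqP; exact: ut.
pose c := (\sum_s conjc (u' s) * (X s - A' s)) / N.
exists (fun s => c * u' s + A' s); first exact: PD.
have orthu : \sum_s conjc (u' s) * (X s - (c * u' s + A' s)) = 0.
  rewrite (eq_bigr (fun s => conjc (u' s) * (X s - A' s) - c * (conjc (u' s) * u' s))).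
    by rewrite sumrB -mulr_sumr -/N /c divfK // subrr.
  by move=> s _; ring.
have orthw w : P' w -> \sum_s conjc (w s) * (X s - (c * u' s + A' s)) = 0.
  move=> P'w.
  rewrite (eq_bigr (fun s => conjc (w s) * (X s - A' s) - c * (conjc (w s) * u' s))).
    rewrite sumrB -mulr_sumr A'orth //; under eq_bigr do rewrite u'E.
    by rewrite Borth // mulr0 subrr.
  by move=> s _; ring.
(* Subtracting the multiple of [u'] that matches [Z] at [t] leaves a member of [P'], so
   orthogonality to [u'] and to [P'] suffices. *)
move=> Z PZ; have [b bE] : exists b, b * u' t = Z t.
  by exists (Z t / u' t); rewrite divfK // u't; apply/eqP.
have P'Z : P' (fun s => - b * u' s + Z s).
  by split; [exact: PD|rewrite mulNr bE addNr].
rewrite (eq_bigr (fun s =>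
    conjc (- b * u' s + Z s) * (X s - (c * u' s + A' s)) +
    conjc b * (conjc (u' s) * (X s - (c * u' s + A' s))))).
  by rewrite big_split /= -mulr_sumr orthu orthw // mulr0 addr0.
move=> s _; rewrite mulrA -mulrDl; congr (_ * _).
by rewrite rmorphD !rmorphM rmorphN /=; ring.
Qed.

(** * Conjugation, finite sums and positive semidefinite kernels *)

Lemma conjcD (x y : CC) : conjc (x + y) = conjc x + conjc y.
Proof. exact: rmorphD. Qed.

Lemma conjcM (x y : CC) : conjc (x * y) = conjc x * conjc y.
Proof. exact: rmorphM. Qed.

Lemma conjcN (x : CC) : conjc (- x) = - conjc x.
Proof. exact: rmorphN. Qed.

Lemma conjc_sum (I : finType) (F : I -> CC) :
  conjc (\sum_i F i) = \sum_i conjc (F i).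
Proof. exact: rmorph_sum. Qed.

(** Lets [ring] prove an equation modulo a known one [c = d]: only the identity of the two
    differences is left to check. *)
Lemma eq_from_sub (V : zmodType) (a b c d : V) : c = d -> a - b = c - d -> a = b.
Proof. by move=> -> /eqP; rewrite subrr subr_eq0 => /eqP. Qed.

Lemma sum_pair (I T : finType) (F : I * T -> CC) :
  \sum_p F p = \sum_i \sum_x F (i, x).
Proof. by rewrite pair_bigA; apply: eq_bigr => -[]. Qed.

Lemma sum_pick (S : finType) (F : S -> CC) r : \sum_s F s * (s == r)%:R = F r.
Proof.
rewrite (bigD1 r) //= eqxx mulr1 big1 ?addr0 // => s /negPf ->.
by rewrite mulr0.
Qed.

Lemma sum_pickZ (S : finType) (F : S -> CC) (c : CC) r :
  \sum_s F s * (c * (s == r)%:R) = F r * c.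
Proof. by under eq_bigr do rewrite mulrA; rewrite sum_pick. Qed.

(** Polarisation: nonnegative values are real. The form at [e_p] and [e_q] shows that the diagonal
    entries are real; at [e_p + e_q] and [e_p + 'i e_q] it gives two equations whose sum is twice
    the claim. *)
Lemma psd_hermitian (S : finType) (Y : S -> S -> CC) :
  psd Y -> forall p q, Y p q = conjc (Y q p).
Proof.
move=> Ypsd p q.
have quadE (a b : CC) :
    0 <= conjc a * Y p p * a + conjc a * Y p q * b +
         (conjc b * Y q p * a + conjc b * Y q q * b).
  have := Ypsd (fun s => a * (s == p)%:R + b * (s == q)%:R).
  congr (_ <= _).
  transitivity (\sum_s conjc (a * (s == p)%:R + b * (s == q)%:R) *
                 (Y s p * a + Y s q * b)).
    apply: eq_bigr => s _; under eq_bigr do rewrite -mulrA mulrDr.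
    by rewrite -mulr_sumr big_split /= !sum_pickZ.
  transitivity (\sum_s ((Y s p * a + Y s q * b) * (conjc a * (s == p)%:R) +
                        (Y s p * a + Y s q * b) * (conjc b * (s == q)%:R))).
    apply: eq_bigr => s _.
    by rewrite conjcD !conjcM !conjc_nat mulrC mulrDr.
  by rewrite big_split /= !sum_pickZ; ring.
have real0 (x : CC) : 0 <= x -> conjc x = x :> CC.
  by move=> /ger0_real/CrealP.
have real_pp : conjc (Y p p) = Y p p.
  have := real0 _ (quadE 1 0).
  by rewrite !(conjc0, conjc1, mulr0, mul0r, mulr1, mul1r, addr0, add0r).
have real_qq : conjc (Y q q) = Y q q.
  have := real0 _ (quadE 0 1).
  by rewrite !(conjc0, conjc1, mulr0, mul0r, mulr1, mul1r, addr0, add0r).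
have real_cross (b : CC) :
    conjc (Y p q) * conjc b + b * conjc (Y q p) = Y p q * b + conjc b * Y q p :> CC.
  have := real0 _ (quadE 1 b); rewrite !(conjcD, conjcM) !conjcK real_pp real_qq.
  rewrite ?conjc1 => e; apply: (eq_from_sub e); ring.
have iE : conjc ('i : CC) = - 'i by exact: conjCi.
have iN0 : ('i : CC) != 0 by exact: neq0Ci.
have e1 : conjc (Y q p) + conjc (Y p q) = Y p q + Y q p :> CC.
  have := real_cross 1; rewrite conjc1 => e; apply: (eq_from_sub e); ring.
have e2 : conjc (Y q p) - conjc (Y p q) = Y p q - Y q p :> CC.
  apply: (mulfI iN0); have := real_cross 'i; rewrite iE => e.
  by apply: (eq_from_sub e); ring.
have e3 : 2 * Y p q = 2 * conjc (Y q p) :> CC.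
  by apply: (eq_from_sub (esym (congr2 +%R e1 e2))); ring.
by apply: (mulfI _ e3); rewrite pnatr_eq0.
Qed.
Lemma psd_diag_ge0 (S : finType) (Y : S -> S -> CC) p : psd Y -> 0 <= Y p p.
Proof.
move=> /(_ (fun s => (s == p)%:R)); congr (_ <= _).
under eq_bigr do rewrite sum_pick conjc_nat mulrC.
exact: sum_pick.
Qed.

(* Test against [c *: e_p + e_q] with [c := - t * Y p q], [t] large. *)
Lemma psd_diag0 (S : finType) (Y : S -> S -> CC) p q :
  psd Y -> Y p p = 0 -> Y p q = 0.
Proof.
move=> Ypsd Ypp; apply/eqP/negPn/negP => pqN0; have Yqp := psd_hermitian Ypsd q p.
have Yqq := psd_diag_ge0 q Ypsd.
pose m : CC := conjc (Y p q) * Y p q.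
have m_gt0 : 0 < m by rewrite lt0r mulf_neq0 ?conjc_eq0 // /m mulrC mul_conjC_ge0.
have [t tm] : exists t, t * m = Y q q + 1.
  by exists ((Y q q + 1) / m); rewrite divfK // gt_eqF.
have := Ypsd (fun s => - t * Y p q * (s == p)%:R + (s == q)%:R).
have t_ge0 : 0 < t by rewrite -(pmulr_lgt0 _ m_gt0) tm ltr_wpDl.
have tE : conjc t = t by apply/CrealP/ger0_real/ltW.
have -> : \sum_s \sum_r
    conjc (- t * Y p q * (s == p)%:R + (s == q)%:R) * Y s r *
    (- t * Y p q * (r == p)%:R + (r == q)%:R) =
    Y q q - 2 * t * (conjc (Y p q) * Y p q).
  transitivity (\sum_s conjc (- t * Y p q * (s == p)%:R + (s == q)%:R) *
                 (Y s p * (- t * Y p q) + Y s q)).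
    apply: eq_bigr => s _; under eq_bigr do rewrite -mulrA mulrDr.
    by rewrite -mulr_sumr big_split /= !(sum_pick, sum_pickZ).
  transitivity (\sum_s
     ((Y s p * (- t * Y p q) + Y s q) * (- t * conjc (Y p q) * (s == p)%:R) +
      (Y s p * (- t * Y p q) + Y s q) * (s == q)%:R)).
    apply: eq_bigr => s _.
    by rewrite conjcD !conjcM conjcN !conjc_nat tE; ring.
  by rewrite big_split /= !(sum_pick, sum_pickZ) Ypp Yqp; ring.
rewrite -mulrA tm.
have -> : Y q q - 2 * (Y q q + 1) = - (Y q q + 2) by ring.
by rewrite oppr_ge0 lt_geF // ltr_wpDl.
Qed.

(** * The algebra of matrices indexed by [k]-tuples, its trace inner product and its index
    permutations *)

Section MatrixAlgebra.
Variables (V : finType) (k : nat).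
Implicit Types (X Y Z : Mat V k).

Lemma mx_ext X Y : (forall x y, X x y = Y x y) -> X = Y.
Proof. by move=> e; apply/funext => x; apply/funext => y. Qed.

Lemma mx_mulA X Y Z : mx_mul X (mx_mul Y Z) = mx_mul (mx_mul X Y) Z.
Proof.
apply: mx_ext => x y; rewrite /mx_mul.
under eq_bigr do rewrite mulr_sumr; rewrite exchange_big /=.
apply: eq_bigr => z _; rewrite mulr_suml; apply: eq_bigr => t _.
exact: mulrA.
Qed.

Lemma mx_mul1l X : mx_mul (mx_id V k) X = X.
Proof.
apply: mx_ext => x y; rewrite /mx_mul /mx_id.
under eq_bigr do rewrite mulrC eq_sym; exact: sum_pick.
Qed.

Lemma mx_mul1r X : mx_mul X (mx_id V k) = X.
Proof. by apply: mx_ext => x y; exact: sum_pick. Qed.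

Lemma mx_adjK X : mx_adj (mx_adj X) = X.
Proof. by apply: mx_ext => x y; exact: conjcK. Qed.

Lemma mx_adj1 : mx_adj (mx_id V k) = mx_id V k.
Proof. by apply: mx_ext => x y; rewrite /mx_adj /mx_id conjc_nat eq_sym. Qed.

Lemma mx_adjM X Y : mx_adj (mx_mul X Y) = mx_mul (mx_adj Y) (mx_adj X).
Proof.
apply: mx_ext => x y; rewrite /mx_adj /mx_mul conjc_sum.
by apply: eq_bigr => z _; rewrite conjcM mulrC.
Qed.

Lemma mx_trC X Y : mx_tr (mx_mul X Y) = mx_tr (mx_mul Y X).
Proof.
rewrite /mx_tr /mx_mul exchange_big /=.
by apply: eq_bigr => x _; apply: eq_bigr => y _; exact: mulrC.
Qed.

Lemma tr_innerE X Y : tr_inner X Y = mx_tr (mx_mul (mx_adj X) Y).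
Proof. by rewrite /tr_inner exchange_big. Qed.

Lemma tr_inner_id X : tr_inner (mx_id V k) X = mx_tr X.
Proof. by rewrite tr_innerE mx_adj1 mx_mul1l. Qed.

Lemma tr_inner_mulr X Y Z :
  tr_inner (mx_mul X (mx_adj Y)) Z = tr_inner X (mx_mul Z Y).
Proof. by rewrite !tr_innerE mx_adjM mx_adjK -mx_mulA mx_trC mx_mulA. Qed.

Lemma conj_tr_inner X Y : conjc (tr_inner X Y) = tr_inner Y X.
Proof.
rewrite /tr_inner conjc_sum; apply: eq_bigr => x _; rewrite conjc_sum.
by apply: eq_bigr => y _; rewrite conjcM conjcK mulrC.
Qed.

Lemma tr_inner_linear a X Y Z :
  tr_inner Z (mx_add (mx_scale a X) Y) = a * tr_inner Z X + tr_inner Z Y.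
Proof.
rewrite /tr_inner mulr_sumr -big_split; apply: eq_bigr => x _ /=.
rewrite mulr_sumr -big_split; apply: eq_bigr => y _ /=.
by rewrite /mx_add /mx_scale; ring.
Qed.

Lemma tr_inner_eq0 X : tr_inner X X = 0 -> forall x y, X x y = 0.
Proof.
move=> X0 x y; have sq_ge0 u v : 0 <= conjc (X u v) * X u v.
  by rewrite mulrC mul_conjC_ge0.
have := psumr_eq0P (fun u _ => sumr_ge0 _ (fun v _ => sq_ge0 u v)) X0.
move=> /(_ x isT) /(psumr_eq0P (fun v _ => sq_ge0 x v)) /(_ y isT) /eqP.
by rewrite mulf_eq0 conjc_eq0 orbb => /eqP.
Qed.

Lemma tr_inner_adj X Y : tr_inner (mx_adj X) (mx_adj Y) = tr_inner Y X.
Proof.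
rewrite /tr_inner exchange_big; apply: eq_bigr => x _; apply: eq_bigr => y _.
by rewrite /mx_adj conjcK mulrC.
Qed.

Definition mx_sub X Y := mx_add (mx_scale (-1) Y) X.

Lemma mx_subE X Y x y : mx_sub X Y x y = X x y - Y x y.
Proof. by rewrite /mx_sub /mx_add /mx_scale mulN1r addrC. Qed.

Lemma tr_inner_sub_eq0 X Y : tr_inner (mx_sub X Y) (mx_sub X Y) = 0 -> X = Y.
Proof.
move=> XY; apply: mx_ext => x y; apply/eqP; rewrite -subr_eq0 -mx_subE.
by rewrite (tr_inner_eq0 XY).
Qed.

(** [is_linear] speaks of [a X + Y] only; this form yields homogeneity from it without knowing the
    image of 0. *)
Lemma mx_scaleE a X : mx_scale a X = mx_add (mx_scale (a - 1) X) X.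
Proof. by apply: mx_ext => x y; rewrite /mx_scale /mx_add; ring. Qed.

Lemma mx_addE X Y : mx_add X Y = mx_add (mx_scale 1 X) Y.
Proof. by apply: mx_ext => x y; rewrite /mx_scale /mx_add mul1r. Qed.

Lemma mx_mulDl a X Y Z : mx_mul (mx_add (mx_scale a X) Y) Z =
  mx_add (mx_scale a (mx_mul X Z)) (mx_mul Y Z).
Proof.
apply: mx_ext => x y; rewrite /mx_mul /mx_add /mx_scale mulr_sumr -big_split.
by apply: eq_bigr => z _ /=; ring.
Qed.

Lemma mx_adj_linear a X Y : mx_adj (mx_add (mx_scale a X) Y) =
  mx_add (mx_scale (conjc a) (mx_adj X)) (mx_adj Y).
Proof. by apply: mx_ext => x y; rewrite /mx_adj conjcD conjcM. Qed.

Lemma mx_perm1 X : mx_perm 1%g X = X.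
Proof.
apply: mx_ext => x y; rewrite /mx_perm invg1.
congr (X _ _); apply/ffunP => i; rewrite ffunE perm1 /join2.
  by have := unsplitK (inl i : 'I_k + 'I_k)%type; rewrite /= => ->.
by have := unsplitK (inr i : 'I_k + 'I_k)%type; rewrite /= => ->.
Qed.

Lemma join2_ffun (F : 'I_(k + k) -> V) i :
  join2 [ffun j => F (lshift k j)] [ffun j => F (rshift k j)] i = F i.
Proof. by rewrite /join2; case: splitP => j ij; rewrite ffunE; congr F; exact/val_inj. Qed.

Lemma mx_permM s t X : mx_perm s (mx_perm t X) = mx_perm (s * t)%g X.
Proof.
apply: mx_ext => x y; rewrite /mx_perm; congr (X _ _); apply/ffunP => i.
all: rewrite !ffunE (join2_ffun (fun j => join2 x y ((s^-1)%g j))).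
all: by rewrite invMg permM.
Qed.

Lemma mx_permK s X : mx_perm s^-1%g (mx_perm s X) = X.
Proof. by rewrite mx_permM mulVg mx_perm1. Qed.

Lemma mx_permVK s X : mx_perm s (mx_perm s^-1%g X) = X.
Proof. by rewrite mx_permM mulgV mx_perm1. Qed.

Lemma tr_inner_perm s X Y :
  tr_inner (mx_perm s X) (mx_perm s Y) = tr_inner X Y.
Proof.
rewrite /tr_inner !pair_bigA /=.
pose f (t : {perm 'I_(k + k)}) (p : tup V k * tup V k) : tup V k * tup V k :=
  ([ffun i => join2 p.1 p.2 ((t^-1)%g (lshift k i))],
   [ffun i => join2 p.1 p.2 ((t^-1)%g (rshift k i))]).
(* Bijectivity of the action on index pairs is read off from [mx_permVK], tested on the matrix unit
   at [(x, y)]. *)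
have fK t : cancel (f t) (f t^-1)%g.
  move=> [x y]; have fE (Z : Mat V k) :
      Z (f t^-1 (f t (x, y)))%g.1 (f t^-1 (f t (x, y)))%g.2 = Z x y.
    exact: (congr1 (fun W : Mat V k => W x y) (mx_permVK t Z)).
  apply/eqP; move: (fE (mx_unit x y)); rewrite /mx_unit !eqxx /= -pair_eqE.
  rewrite /pair_eq /=; case: (_ && _) => // /eqP.
  by rewrite eq_sym oner_eq0.
rewrite [RHS](reindex (f s)) //=; exists (f s^-1)%g => p _; first exact: fK.
by rewrite -{1}[s]invgK fK.
Qed.

Lemma tr_inner_permV s X Y :
  tr_inner X (mx_perm s Y) = tr_inner (mx_perm s^-1%g X) Y.
Proof. by rewrite -[in RHS](mx_permK s Y) tr_inner_perm. Qed.

End MatrixAlgebra.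

(** * Unital completely positive maps and their multiplicative domain *)

Section CompletelyPositive.
Variables (V W : finType) (k : nat) (Phi : Mat V k -> Mat W k).
Hypothesis Phi_lin : is_linear Phi.
Hypothesis Phi_cp : completely_positive Phi.
Hypothesis Phi1 : Phi (mx_id V k) = mx_id W k.

(** The form at [v] is the squared norm of the vector [u], the sum of the [R i] applied to the
    blocks of [v]. *)
Lemma gram_psd n (R : 'I_n -> Mat V k) :
  psd (fun p q : 'I_n * tup V k => mx_mul (mx_adj (R p.1)) (R q.1) p.2 q.2).
Proof.
move=> v; pose u z := \sum_(p : 'I_n * tup V k) R p.1 z p.2 * v p.
suff -> : \sum_p \sum_q conjc (v p) * mx_mul (mx_adj (R p.1)) (R q.1) p.2 q.2 * v q
    = \sum_z conjc (u z) * u z.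
  by apply: sumr_ge0 => z _; rewrite mulrC mul_conjC_ge0.
transitivity (\sum_p \sum_q \sum_z (conjc (R p.1 z p.2 * v p) * (R q.1 z q.2 * v q))).
  apply: eq_bigr => p _; apply: eq_bigr => q _.
  rewrite mulr_sumr mulr_suml; apply: eq_bigr => z _.
  by rewrite /mx_adj conjcM; ring.
under eq_bigr do rewrite exchange_big; rewrite exchange_big /=.
apply: eq_bigr => z _; rewrite conjc_sum mulr_suml; apply: eq_bigr => p _.
by rewrite mulr_sumr.
Qed.

Lemma gram_map_psd n (R : 'I_n -> Mat V k) :
  psd (fun p q : 'I_n * tup W k => Phi (mx_mul (mx_adj (R p.1)) (R q.1)) p.2 q.2).
Proof. exact: Phi_cp (gram_psd R). Qed.

(** The block matrix with rows [(1, M)] and [(M^*, M^* M)] is positive, so its image is Hermitian;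
    compare the off-diagonal blocks. *)
Lemma map_adj M : Phi (mx_adj M) = mx_adj (Phi M).
Proof.
apply: mx_ext => x y; pose R (i : 'I_2) := if i == ord0 then mx_id V k else M.
have := psd_hermitian (gram_map_psd R) (ord_max, x) (ord0, y).
by rewrite /R /= mx_adj1 mx_mul1l mx_mul1r.
Qed.

Lemma sum_ord_recl_pair (T : finType) n (F : 'I_n.+1 * T -> CC) :
  \sum_p F p = \sum_x F (ord0, x) + \sum_(p : 'I_n * T) F (lift ord0 p.1, p.2).
Proof. by rewrite sum_pair big_ord_recl pair_bigA. Qed.

(* Complete positivity is applied to the family [R] extended by the identity. *)
Lemma schwarz_psd n (R : 'I_n -> Mat V k) :
  psd (fun p q : 'I_n * tup W k =>
         Phi (mx_mul (mx_adj (R p.1)) (R q.1)) p.2 q.2 -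
         mx_mul (mx_adj (Phi (R p.1))) (Phi (R q.1)) p.2 q.2).
Proof.
move=> w; pose u x := \sum_(q : 'I_n * tup W k) Phi (R q.1) x q.2 * w q.
pose R' i := if unlift ord0 i is Some j then R j else mx_id V k.
(* The coordinate [- u] on the identity block completes the square: that block contributes the
   squared norm of [u] once, the two cross terms subtract it twice, and by [uu] what remains is the
   form of the defect at [w]. *)
pose v (p : 'I_n.+1 * tup W k) : CC :=
  if unlift ord0 p.1 is Some j then w (j, p.2) else - u p.2.
have R'0 : R' ord0 = mx_id V k by rewrite /R' unlift_none.
have R'S j : R' (lift ord0 j) = R j by rewrite /R' liftK.
have v0 x : v (ord0, x) = - u x by rewrite /v unlift_none.
have vS p : v (lift ord0 p.1, p.2) = w p by rewrite /v liftK -surjective_pairing.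
have uu : \sum_p \sum_q conjc (w p) *
    mx_mul (mx_adj (Phi (R p.1))) (Phi (R q.1)) p.2 q.2 * w q =
    \sum_x conjc (u x) * u x.
  transitivity (\sum_p \sum_q \sum_x
      (conjc (Phi (R p.1) x p.2 * w p) * (Phi (R q.1) x q.2 * w q))).
    apply: eq_bigr => p _; apply: eq_bigr => q _.
    rewrite mulr_sumr mulr_suml; apply: eq_bigr => x _.
    by rewrite /mx_adj conjcM; ring.
  under eq_bigr do rewrite exchange_big; rewrite exchange_big /=.
  apply: eq_bigr => x _; rewrite conjc_sum mulr_suml; apply: eq_bigr => p _.
  by rewrite mulr_sumr.
have := gram_map_psd R' v; congr (_ <= _).
rewrite sum_ord_recl_pair /=.
under eq_bigr do rewrite sum_ord_recl_pair /= R'0 mx_adj1 mx_mul1l Phi1 v0.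
under [X in _ + X]eq_bigr do
  rewrite sum_ord_recl_pair /= R'0 R'S mx_mul1r map_adj vS.
rewrite !big_split /=.
have -> : \sum_x \sum_y conjc (- u x) * mx_id W k x y * v (ord0, y) =
    \sum_x conjc (u x) * u x.
  apply: eq_bigr => x _; under eq_bigr do rewrite v0 mulrAC /mx_id eq_sym.
  by rewrite sum_pick conjcN mulrNN.
have -> : \sum_x \sum_q conjc (- u x) *
    Phi (mx_mul (mx_id V k) (R' (lift ord0 q.1))) x q.2 * v (lift ord0 q.1, q.2) =
    - \sum_x conjc (u x) * u x.
  rewrite -sumrN; apply: eq_bigr => x _.
  under eq_bigr do rewrite mx_mul1l R'S vS -mulrA.
  by rewrite -mulr_sumr conjcN mulNr.
have -> : \sum_p \sum_y conjc (w p) * mx_adj (Phi (R p.1)) p.2 y * v (ord0, y) =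
    - \sum_x conjc (u x) * u x.
  rewrite exchange_big -sumrN; apply: eq_bigr => x _ /=.
  under eq_bigr do rewrite v0; rewrite -mulr_suml mulrN; congr (- (_ * _)).
  by rewrite conjc_sum; apply: eq_bigr => p _; rewrite conjcM mulrC.
rewrite subrr add0r -uu -sumrN -big_split; apply: eq_bigr => p _ /=.
rewrite -sumrN -big_split; apply: eq_bigr => q _ /=.
by rewrite R'S vS; ring.
Qed.

Hypothesis Phi_tr : forall X, mx_tr (Phi X) = mx_tr X.

Let defect M x :=
  Phi (mx_mul (mx_adj M) M) x x - mx_mul (mx_adj (Phi M)) (Phi M) x x.

Let defect_ge0 M x : 0 <= defect M x.
Proof. exact: (psd_diag_ge0 (ord0, x) (schwarz_psd (fun _ : 'I_1 => M))). Qed.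

Let sum_defect M : \sum_x defect M x = tr_inner M M - tr_inner (Phi M) (Phi M).
Proof. by rewrite sumrB !tr_innerE -[X in _ = X - _]Phi_tr. Qed.

(** The loss of squared norm is the trace of the defect, whose diagonal entries are nonnegative. *)
Lemma map_contraction M : tr_inner (Phi M) (Phi M) <= tr_inner M M.
Proof. by rewrite -subr_ge0 -sum_defect sumr_ge0. Qed.

(** A one-sided multiplicative domain; [mult_domain_adj] turns it into multiplicativity for products
    [M N]. *)
Definition mult_domain M :=
  forall N, Phi (mx_mul (mx_adj M) N) = mx_mul (mx_adj (Phi M)) (Phi N).

(** If the norm is preserved, the defect of [M] has trace 0, hence zero diagonal. In the positive
    defect kernel of the pair [M, N] a zero diagonal entry kills its whole row, which contains the
    mixed defect of [M] and [N]. *)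
Lemma mult_domainP M :
  mult_domain M <-> tr_inner (Phi M) (Phi M) = tr_inner M M.
Proof.
split=> [MD|isoM N]; first by rewrite !tr_innerE -MD Phi_tr.
apply: mx_ext => x y.
pose R (i : 'I_2) := if i == ord0 then M else N.
have := psd_diag0 (ord_max, y) (schwarz_psd R) (p := (ord0, x)).
rewrite /R /= => D0; apply/eqP; rewrite -subr_eq0; apply/eqP/D0.
have := sum_defect M; rewrite isoM subrr.
by move=> /(psumr_eq0P (fun x _ => defect_ge0 M x)) /(_ x isT).
Qed.

Lemma mult_domain_adj M : mult_domain M -> mult_domain (mx_adj M).
Proof. by rewrite !mult_domainP map_adj !tr_inner_adj. Qed.

Lemma mult_domain_mulE M N : mult_domain M ->
  Phi (mx_mul M N) = mx_mul (Phi M) (Phi N).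
Proof. by move/mult_domain_adj/(_ N); rewrite mx_adjK map_adj mx_adjK. Qed.

Lemma mult_domain1 : mult_domain (mx_id V k).
Proof. by move=> N; rewrite Phi1 !mx_adj1 !mx_mul1l. Qed.

Lemma mult_domain_linear a M N : mult_domain M -> mult_domain N ->
  mult_domain (mx_add (mx_scale a M) N).
Proof.
move=> MD ND X; rewrite mx_adj_linear mx_mulDl Phi_lin MD ND.
by rewrite Phi_lin mx_adj_linear mx_mulDl.
Qed.

Lemma mult_domain_mul M N : mult_domain M -> mult_domain N ->
  mult_domain (mx_mul M N).
Proof.
move=> MD ND X.
by rewrite mx_adjM -mx_mulA ND MD mult_domain_mulE // mx_adjM -mx_mulA.
Qed.

(** The difference lies in the domain too, and [Phi] preserves its norm. *)
Lemma mult_domain_inj M N : mult_domain M -> mult_domain N ->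
  Phi M = Phi N -> M = N.
Proof.
move=> MD ND eMN; apply: tr_inner_sub_eq0.
rewrite -(proj1 (mult_domainP _)); last exact: mult_domain_linear.
rewrite Phi_lin eMN /tr_inner big1 // => x _; rewrite big1 // => y _.
by rewrite /mx_add /mx_scale mulN1r addNr mulr0.
Qed.

(* Pythagoras: both halves of [M = F . M + (J - F) . M] are contracted, so if
   [Phi] preserves the norm of [M] it preserves the norm of each half. *)
Lemma mult_domain_had (F : Mat V k) (F' : Mat W k) M :
  (forall x y, F x y * F x y = F x y) -> (forall x y, F' x y * F' x y = F' x y) ->
  (forall x y, conjc (F x y) = F x y) -> (forall x y, conjc (F' x y) = F' x y) ->
  Phi (mx_had F M) = mx_had F' (Phi M) ->
  mult_domain M -> mult_domain (mx_had F M).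
Proof.
move=> F01 F'01 Freal F'real PhiF /mult_domainP isoM; apply/mult_domainP.
have pyth (U : finType) (E X : Mat U k) : (forall x y, E x y * E x y = E x y) ->
    (forall x y, conjc (E x y) = E x y) ->
    tr_inner (mx_had E X) (mx_had E X) +
    tr_inner (mx_sub X (mx_had E X)) (mx_sub X (mx_had E X)) = tr_inner X X.
  move=> E01 Ereal; rewrite /tr_inner -big_split; apply: eq_bigr => x _ /=.
  rewrite -big_split; apply: eq_bigr => y _ /=.
  rewrite !mx_subE /mx_had conjcD conjcN conjcM Ereal.
  (* The two sides differ by [2 |X x y|^2 (E^2 - E)], which vanishes for an idempotent entry. *)
  apply: (@eq_from_sub _ _ _ _ _ (congr1 (fun e => 2 * conjc (X x y) * X x y * e) (E01 x y))).
  by ring.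
apply/eqP; rewrite eq_le map_contraction /=.
have := map_contraction (mx_sub M (mx_had F M)).
rewrite {1 2}/mx_sub Phi_lin -/(mx_sub _ _) PhiF.
have := pyth _ F' (Phi M) F'01 F'real; rewrite isoM -(pyth _ F M F01 Freal).
move=> e; rewrite -(lerD2l (tr_inner (mx_had F' (Phi M)) (mx_had F' (Phi M)))) e.
by rewrite lerD2r.
Qed.

Lemma mult_domain_perm s M : Phi (mx_perm s M) = mx_perm s (Phi M) ->
  mult_domain M -> mult_domain (mx_perm s M).
Proof. by move=> e; rewrite !mult_domainP e !tr_inner_perm. Qed.

End CompletelyPositive.

(** * Homomorphism tensors of graphs all of whose vertices are labelled *)

Section Homtensor.
Variable k : nat.

Definition all_labelled (F : bgraph k) :=
  forall a, (exists i, bin F i = a) \/ (exists i, bout F i = a).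

(** Only unlabelled vertices may be deleted, so here no vertex deletion occurs; a contraction
    carries labels along a surjection. *)
Lemma minor_step_all_labelled (F1 F2 : bgraph k) :
  minor_step F1 F2 -> all_labelled F1 -> all_labelled F2.
Proof.
case=> [n E u v a b _ //|n m E u v w f E' u' v' _ _ uw vw _ _ _ lab|].
  by case: (lab w) => [[i /eqP]|[i /eqP]]; rewrite /= ?(negPf (uw i)) ?(negPf (vw i)).
move=> n m E u v a b g E' _ g_onto _ _ lab p.
have /codomP [x ->] := g_onto p.
by case: (lab x) => -[i <-]; [left|right]; exists i.
Qed.

Lemma bminor_all_labelled (F F' : bgraph k) :
  bminor F F' -> all_labelled F -> all_labelled F'.
Proof. by elim=> // F1 F2 _ IH /minor_step_all_labelled H /IH. Qed.

Lemma Qk_all_labelled (F : bgraph k) : Qk F -> all_labelled F.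
Proof.
have lab (E : rel 'I_(k + k)) :
    all_labelled (BGraph E (fun i : 'I_k => lshift k i) (fun i : 'I_k => rshift k i)).
  move=> a /=; rewrite -[a]splitK; case: (split a) => i /=; [left|right]; by exists i.
by case=> /bminor_all_labelled; apply; exact: lab.
Qed.

Variables (V : finType) (e : rel V).

(** The labels fix the image of every vertex, so at most one homomorphism is counted and the entry
    is 0 or 1. *)
Lemma homtensor_idem (F : bgraph k) x y : all_labelled F ->
  homtensor F e x y * homtensor F e x y = homtensor F e x y.
Proof.
move=> lab; rewrite /homtensor; set A := [set _ | _].
suff : (#|A| <= 1)%N by case: #|A| => [|[|]] // _; rewrite ?mulr0 ?mulr1.
apply/card_le1_eqP => h h'; rewrite !inE.
move=> /andP[_ /forallP hl] /andP[_ /forallP hl']; apply/ffunP => a.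
case: (lab a) => -[i <-]; have /andP[/eqP h1 /eqP h2] := hl i.
  by have /andP[/eqP -> _] := hl' i.
by have /andP[_ /eqP ->] := hl' i.
Qed.

Lemma homtensor_real (F : bgraph k) x y :
  conjc (homtensor F e x y) = homtensor F e x y.
Proof. exact: conjc_nat. Qed.

(** Turns the norm of a 0/1 tensor into a pairing with [J], which a quantum isomorphism map
    preserves. *)
Lemma homtensor_norm (F : bgraph k) : all_labelled F ->
  tr_inner (homtensor F e) (homtensor F e) = tr_inner (mx_J V k) (homtensor F e).
Proof.
move=> lab; apply: eq_bigr => x _; apply: eq_bigr => y _.
by rewrite homtensor_real homtensor_idem // /mx_J conjc1 mul1r.
Qed.

End Homtensor.

(** * The adjoint for the trace inner product *)

Section Adjoint.
Variables (V W : finType) (k : nat) (Phi : Mat V k -> Mat W k).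
Hypothesis Phi_lin : is_linear Phi.

Lemma linear_units X u v :
  Phi X u v = \sum_x \sum_y X x y * Phi (mx_unit x y) u v.
Proof.
have XE : X = fun u v => \sum_(p : tup V k * tup V k) X p.1 p.2 * mx_unit p.1 p.2 u v.
  apply: mx_ext => a b; rewrite (bigD1 (a, b)) //= /mx_unit !eqxx mulr1 big1 ?addr0 //.
  move=> [x y] /= xy; suff -> : (a == x) && (b == y) = false by rewrite mulr0.
  by apply: contraNF xy => /andP[/eqP -> /eqP ->].
rewrite pair_bigA /= {1}XE; elim: (index_enum _) => [|p r IH].
  (* The empty sum needs that [Phi] sends 0 to 0; this follows by writing 0 as [-1 * 0 + 0]. *)
  rewrite big_nil; pose Z : Mat V k := fun _ _ => 0.
  transitivity (Phi (mx_add (mx_scale (-1) Z) Z) u v).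
    congr (Phi _ u v); apply: mx_ext => a b.
    by rewrite big_nil /mx_add /mx_scale mulr0 addr0.
  by rewrite Phi_lin /mx_add /mx_scale mulN1r addNr.
rewrite big_cons -IH.
rewrite -[RHS]/(mx_add (mx_scale (X p.1 p.2) (Phi (mx_unit p.1 p.2)))
  (Phi (fun a b => \sum_(q <- r) X q.1 q.2 * mx_unit q.1 q.2 a b)) u v) -Phi_lin.
by congr (Phi _ u v); apply: mx_ext => a b; rewrite big_cons.
Qed.

Lemma tr_inner_lin_adjoint X Y :
  tr_inner Y (Phi X) = tr_inner (lin_adjoint Phi Y) X.
Proof.
rewrite /tr_inner /lin_adjoint.
transitivity (\sum_u \sum_v \sum_x \sum_y
    (conjc (Y u v) * Phi (mx_unit x y) u v * X x y)).
  apply: eq_bigr => u _; apply: eq_bigr => v _; rewrite linear_units mulr_sumr.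
  by apply: eq_bigr => x _; rewrite mulr_sumr; apply: eq_bigr => y _; ring.
rewrite pair_bigA exchange_big /=; under eq_bigr do rewrite exchange_big.
apply: eq_bigr => x _; apply: eq_bigr => y _; rewrite conj_tr_inner.
by rewrite /tr_inner pair_bigA mulr_suml.
Qed.

End Adjoint.

(** * From a quantum isomorphism map to an algebraic equivalence *)

Lemma alg_equiv_of_qiso_map k (VG VH : finType) (eG : rel VG) (eH : rel VH)
  (Phi : Mat VG k -> Mat VH k) :
  qiso_map eG eH Phi -> alg_equiv k eG eH.
Proof.
move=> [lin [cp [had [[id adj_id] [[J adj_J] [hom perm]]]]]].
(* The adjoint conditions at [I] and [J] say that [Phi] preserves the trace and the sum of all
   entries. *)
have trP X : mx_tr (Phi X) = mx_tr X.
  by rewrite -!tr_inner_id tr_inner_lin_adjoint // adj_id.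
have JP X : tr_inner (mx_J VH k) (Phi X) = tr_inner (mx_J VG k) X.
  by rewrite tr_inner_lin_adjoint // adj_J.
have addP X Y : Phi (mx_add X Y) = mx_add (Phi X) (Phi Y).
  by rewrite mx_addE lin -mx_addE.
have scaleP a X : Phi (mx_scale a X) = mx_scale a (Phi X).
  by rewrite mx_scaleE lin -mx_scaleE.
(* Both facts are carried together: membership of the image of a product in the algebra of [H]
   relies on multiplicativity. *)
have qhatP X : qhat eG X -> mult_domain Phi X /\ qhat eH (Phi X).
  elim=> [||M N _ [dM qM] _ [dN qN]|a M _ [dM qM]|M N _ [dM qM] _ [dN qN]
         |M _ [dM qM]|F M QF _ [dM qM]|s M cs _ [dM qM]|F QF].
  - by rewrite id; split; [exact: mult_domain1|exact: QH_id].
  - rewrite J; split; last exact: QH_J.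
    by apply/mult_domainP => //; rewrite J -{2}J JP.
  - rewrite addP; split; last exact: QH_add.
    by rewrite mx_addE; apply: mult_domain_linear.
  - rewrite scaleP; split; last exact: QH_scale.
    by rewrite mx_scaleE; apply: mult_domain_linear.
  - rewrite mult_domain_mulE //; split; last exact: QH_mul.
    exact: mult_domain_mul.
  - rewrite map_adj //; split; last exact: QH_adj.
    exact: mult_domain_adj.
  - have lab : all_labelled F by apply: Qk_all_labelled; left.
    rewrite had //; split; last exact: QH_had.
    apply: (mult_domain_had lin cp id trP (F' := homtensor F eH)) => // [x y|x y|x y|x y|].
    + exact: homtensor_idem.
    + exact: homtensor_idem.
    + exact: homtensor_real.
    + exact: homtensor_real.
    + exact: had.
  - rewrite perm //; split; last exact: QH_perm.
    by apply: mult_domain_perm => //; exact: perm.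
  - rewrite hom //; split; last exact: QH_hom.
    apply/mult_domainP => //.
    have lab := Qk_all_labelled QF.
    by rewrite hom // !homtensor_norm // -hom // JP.
exists Phi; split; first by move=> X /qhatP [].
split; first by move=> a X Y _ _; exact: lin.
split.
  move=> X Y /qhatP [dX _] /qhatP [dY _]; exact: mult_domain_inj.
split.
  (* Surjectivity by induction on the generation of [Y]: [Phi] intertwines every generator and
     operation, so each lifts to the algebra of [G]. *)
  move=> Y; elim=> [||M N _ [X qX <-] _ [Y' qY <-]|a M _ [X qX <-]
    |M N _ [X qX <-] _ [Y' qY <-]|M _ [X qX <-]|F M QF _ [X qX <-]
    |s M cs _ [X qX <-]|F QF].
  - by exists (mx_id VG k); [exact: QH_id|].
  - by exists (mx_J VG k); [exact: QH_J|].
  - by exists (mx_add X Y'); [exact: QH_add|].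
  - by exists (mx_scale a X); [exact: QH_scale|].
  - exists (mx_mul X Y'); [exact: QH_mul|].
    by rewrite mult_domain_mulE //; case: (qhatP _ qX).
  - by exists (mx_adj X); [exact: QH_adj|rewrite map_adj].
  - by exists (mx_had (homtensor F eG) X); [exact: QH_had|exact: had].
  - by exists (mx_perm s X); [exact: QH_perm|exact: perm].
  - by exists (homtensor F eG); [exact: QH_hom|exact: hom].
split; first by move=> M _; exact: map_adj.
split; first by move=> M N /qhatP [dM _] _; exact: mult_domain_mulE.
split; first by move=> F M QF _; exact: had.
split; first by [].
split; first exact: hom.
by split=> [s M cs _|M _]; [exact: perm|exact: trP].
Qed.

(** * Orthogonal projection onto the algebra of a graph *)

Section Projection.
Variables (V : finType) (k : nat) (e : rel V).
Implicit Types (X Y Z : Mat V k).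

Lemma qhat_linear a X Y : qhat e X -> qhat e Y -> qhat e (mx_add (mx_scale a X) Y).
Proof. by move=> qX qY; apply: QH_add qY; exact: QH_scale. Qed.

Lemma qhat0 : qhat e ((fun _ _ => 0) : Mat V k).
Proof.
have := QH_scale 0 (@QH_id k V e); congr (qhat e _).
by apply: mx_ext => x y; exact: mul0r.
Qed.

Lemma qhat_sum (I : finType) (F : I -> Mat V k) :
  (forall i, qhat e (F i)) -> qhat e (fun x y => \sum_i F i x y).
Proof.
move=> qF; elim: (index_enum I) => [|i r IH].
  by have := qhat0; congr (qhat e _); apply: mx_ext => x y; rewrite big_nil.
have := QH_add (qF i) IH; congr (qhat e _); apply: mx_ext => x y.
by rewrite big_cons.
Qed.

(** In a finite group [s^-1] is a natural power of [s], so closure under [s] itself suffices. *)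
Lemma qhat_permV s X : in_cyc s -> qhat e X -> qhat e (mx_perm s^-1%g X).
Proof.
move=> cs qX; rewrite invg_expg; elim: (_.-1) => [|n IH].
  by rewrite expg0 mx_perm1.
by rewrite expgS -mx_permM; exact: QH_perm.
Qed.

Lemma qhat_proj_exists X :
  exists2 A, qhat e A & forall Z, qhat e Z -> tr_inner Z A = tr_inner Z X.
Proof.
pose P (f : tup V k * tup V k -> CC) := qhat e (fun x y => f (x, y)).
have PD a u v : P u -> P v -> P (fun t => a * u t + v t) by exact: qhat_linear.
have [A PA Aorth] := orth_proj_exists (qhat0 : P _) PD (fun t => X t.1 t.2).
exists (fun x y => A (x, y)) => // Z qZ.
have /Aorth e0 : P (fun t => Z t.1 t.2) by [].
apply: esym; apply: (eq_from_sub e0); rewrite subr0 /tr_inner !pair_bigA -sumrB.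
by apply: eq_bigr => -[x y] _ /=; rewrite mulrBr.
Qed.

Definition qhat_proj X : Mat V k := s2val (cid2 (qhat_proj_exists X)).

Lemma qhat_proj_in X : qhat e (qhat_proj X).
Proof. by rewrite /qhat_proj; case: cid2. Qed.

Lemma tr_inner_proj X Z : qhat e Z -> tr_inner Z (qhat_proj X) = tr_inner Z X.
Proof. by rewrite /qhat_proj; case: cid2 => A /= _; apply. Qed.

(** The difference of the two candidates lies in the algebra and is orthogonal to it. Hence an
    operation that preserves the algebra commutes with the projection if its adjoint also does:
    Hadamard multiplication by a real tensor is self-adjoint, and a rotation has its inverse as
    adjoint. *)
Lemma qhat_proj_uniq X A : qhat e A ->
  (forall Z, qhat e Z -> tr_inner Z A = tr_inner Z X) -> qhat_proj X = A.
Proof.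
move=> qA AX; have qE := qhat_proj_in X; apply: tr_inner_sub_eq0.
rewrite {2}/mx_sub tr_inner_linear AX ?tr_inner_proj; last 2 first.
- exact: qhat_linear.
- exact: qhat_linear.
by rewrite mulN1r addNr.
Qed.

Lemma qhat_proj_id X : qhat e X -> qhat_proj X = X.
Proof. by move=> qX; apply: qhat_proj_uniq. Qed.

Lemma qhat_proj_linear a X Y :
  qhat_proj (mx_add (mx_scale a X) Y) =
  mx_add (mx_scale a (qhat_proj X)) (qhat_proj Y).
Proof.
apply: qhat_proj_uniq; first by apply: qhat_linear; exact: qhat_proj_in.
by move=> Z qZ; rewrite !tr_inner_linear !tr_inner_proj.
Qed.

Lemma qhat_proj_adj X : qhat_proj (mx_adj X) = mx_adj (qhat_proj X).
Proof.
apply: qhat_proj_uniq; first by apply: QH_adj; exact: qhat_proj_in.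
move=> Z qZ; rewrite -[Z]mx_adjK !tr_inner_adj -conj_tr_inner tr_inner_proj.
  by rewrite conj_tr_inner.
exact: QH_adj.
Qed.

Lemma qhat_proj_had F X : QP F ->
  qhat_proj (mx_had (homtensor F e) X) = mx_had (homtensor F e) (qhat_proj X).
Proof.
move=> QF; apply: qhat_proj_uniq; first by apply: QH_had => //; exact: qhat_proj_in.
have hadE Z Y : tr_inner Z (mx_had (homtensor F e) Y) =
    tr_inner (mx_had (homtensor F e) Z) Y.
  apply: eq_bigr => x _; apply: eq_bigr => y _.
  by rewrite /mx_had conjcM homtensor_real; ring.
by move=> Z qZ; rewrite !hadE tr_inner_proj //; exact: QH_had.
Qed.

Lemma qhat_proj_perm s X : in_cyc s ->
  qhat_proj (mx_perm s X) = mx_perm s (qhat_proj X).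
Proof.
move=> cs; apply: qhat_proj_uniq; first by apply: QH_perm => //; exact: qhat_proj_in.
by move=> Z qZ; rewrite !tr_inner_permV tr_inner_proj //; exact: qhat_permV.
Qed.

End Projection.

(** * From an algebraic equivalence to a quantum isomorphism map *)

Definition block n (V : finType) k (d : 'I_n * tup V k -> 'I_n * tup V k -> CC)
  (i j : 'I_n) : Mat V k := fun x y => d (i, x) (j, y).

(** Expands [tr(d^* Z d)] into trace inner products of blocks, where the duality between [phi] and
    the projection applies. *)
Lemma block_trace n (V : finType) k
    (d Z : 'I_n * tup V k -> 'I_n * tup V k -> CC) :
  \sum_r \sum_p \sum_q conjc (d p r) * Z p q * d q r =
  \sum_l \sum_i \sum_j
    tr_inner (block d i l) (mx_mul (block Z i j) (block d j l)).
Proof.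
rewrite sum_pair; apply: eq_bigr => l _.
transitivity (\sum_z \sum_i \sum_x \sum_j \sum_y
    conjc (d (i, x) (l, z)) * Z (i, x) (j, y) * d (j, y) (l, z)).
  apply: eq_bigr => z _; rewrite sum_pair; apply: eq_bigr => i _.
  by apply: eq_bigr => x _; rewrite sum_pair.
rewrite exchange_big; apply: eq_bigr => i _ /=.
transitivity (\sum_z \sum_j \sum_x \sum_y
    conjc (d (i, x) (l, z)) * Z (i, x) (j, y) * d (j, y) (l, z)).
  by apply: eq_bigr => z _; rewrite exchange_big.
rewrite exchange_big; apply: eq_bigr => j _ /=.
rewrite exchange_big; apply: eq_bigr => x _; apply: eq_bigr => z _ /=.
by rewrite /mx_mul mulr_sumr; apply: eq_bigr => y _; rewrite mulrA.
Qed.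

Lemma qiso_map_of_alg_equiv k (VG VH : finType) (eG : rel VG) (eH : rel VH) :
  alg_equiv k eG eH -> exists Phi : Mat VG k -> Mat VH k, qiso_map eG eH Phi.
Proof.
case=> phi [inH [lin [_ [onto [adj [mul [had [[id J] [hom [perm trP]]]]]]]]]].
pose E := @qhat_proj VG k eG; have Ein X : qhat eG (E X) := qhat_proj_in eG X.
pose Phi X := phi (E X).
have inner X Y : qhat eG X -> qhat eG Y -> tr_inner (phi X) (phi Y) = tr_inner X Y.
  move=> qX qY; have qX' := QH_adj qX.
  by rewrite !tr_innerE -adj // -mul // trP //; exact: QH_mul.
have innerP Z X : qhat eG Z -> tr_inner (phi Z) (Phi X) = tr_inner Z X.
  by move=> qZ; rewrite inner // tr_inner_proj.
have Phi_fix X : qhat eG X -> Phi X = phi X by move=> qX; rewrite /Phi /E qhat_proj_id.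
have adjP X : Phi (mx_adj X) = mx_adj (Phi X) by rewrite /Phi /E qhat_proj_adj adj.
(* The duality [innerP], tested on a matrix unit, reads off one entry of the adjoint. *)
have adjointE Z : qhat eG Z -> (forall x y, conjc (Z x y) = Z x y) ->
    lin_adjoint Phi (phi Z) = Z.
  move=> qZ Zreal; apply: mx_ext => x y; rewrite /lin_adjoint -conj_tr_inner innerP //.
  rewrite conj_tr_inner /tr_inner (bigD1 x) //= (bigD1 y) //= /mx_unit !eqxx conjc_nat mul1r.
  rewrite !big1 ?addr0 // => [x' /negPf x'x|y' /negPf y'y].
    by apply: big1 => y' _; rewrite x'x conjc0 mul0r.
  by rewrite y'y conjc0 mul0r.
have qI := @QH_id k VG eG; have qJ := @QH_J k VG eG.
exists Phi; split; first by move=> a X Y; rewrite /Phi /E qhat_proj_linear lin.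
split.
  move=> n Y Ypsd.
  apply: (@psd_of_subalgebra _ _ (fun d => forall i j, qhat eH (block d i j))).
  - move=> [i x] [j y] /=.
    rewrite -[RHS]/(mx_adj (Phi (fun x0 y0 => Y (j, x0) (i, y0))) x y) -adjP.
    congr (Phi _ x y); apply: mx_ext => x0 y0; exact: psd_hermitian.
  - move=> i j; have [<-|ij] := eqVneq i j.
      have := @QH_id k VH eH; congr (qhat eH _); apply: mx_ext => x y.
      by rewrite /block /mx_id xpair_eqE eqxx.
    have := qhat0 k eH; congr (qhat eH _); apply: mx_ext => x y.
    by rewrite /block xpair_eqE (negPf ij).
  - by move=> a d d' Bd Bd' i j; apply: (qhat_linear a (Bd i j) (Bd' i j)).
  - move=> d d' Bd Bd' i j.
    have := qhat_sum (fun l => QH_mul (Bd i l) (Bd' l j)); congr (qhat eH _).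
    by apply: mx_ext => x y; rewrite /block sum_pair.
  - by move=> i j; have := inH _ (Ein (block Y i j)).
  move=> d Bd; rewrite block_trace.
  (* Surjectivity of [phi] pulls [d] back block by block to [c]; the trace then becomes
     [tr(c^* Y c)], nonnegative because [Y] is positive. *)
  have /choice [c cP] : forall ij : 'I_n * 'I_n, exists C,
      qhat eG C /\ phi C = block d ij.1 ij.2.
    by move=> ij; have [C] := onto _ (Bd ij.1 ij.2); exists C.
  pose c' p q := c (p.1, q.1) p.2 q.2 : CC.
  have -> : \sum_l \sum_i \sum_j tr_inner (block d i l)
      (mx_mul (block (fun p q => Phi (fun x y => Y (p.1, x) (q.1, y)) p.2 q.2) i j)
              (block d j l)) =
      \sum_l \sum_i \sum_j tr_inner (block c' i l)
        (mx_mul (block Y i j) (block c' j l)).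
    apply: eq_bigr => l _; apply: eq_bigr => i _; apply: eq_bigr => j _.
    have [qil eil] := cP (i, l); have [qjl ejl] := cP (j, l).
    (* The blocks of [Y] need not lie in the algebra. Moving the right factor across leaves
       [Phi (block Y i j)] alone against [phi] of an algebra element, as [innerP] requires. *)
    rewrite /= in eil ejl; rewrite -!tr_inner_mulr -eil -ejl.
    have qjl' := QH_adj qjl.
    rewrite -adj // -mul // -[block (fun p q => Phi _ _ _) i j]/(Phi (block Y i j)).
    by rewrite innerP //; exact: QH_mul.
  rewrite -block_trace; apply: sumr_ge0 => r _; exact: (Ypsd (fun p => c' p r)).
split.
  by move=> F X QF; rewrite /Phi /E qhat_proj_had // had.
split.
  rewrite Phi_fix // id; split=> //; rewrite -{1}id adjointE // => x y.
  exact: conjc_nat.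
split.
  rewrite Phi_fix // J; split=> //; rewrite -{1}J adjointE // => x y.
  exact: conjc1.
split; first by move=> F QF; rewrite Phi_fix ?hom //; exact: QH_hom.
by move=> s X cs; rewrite /Phi /E qhat_proj_perm // perm.
Qed.

Theorem theorem3p10 (k : nat) (VG VH : finType) (eG : rel VG) (eH : rel VH) :
  (1 <= k)%N ->
  symmetric eG -> irreflexive eG ->
  symmetric eH -> irreflexive eH ->
  #|VG| = #|VH| ->
  (alg_equiv k eG eH <-> exists Phi : Mat VG k -> Mat VH k, qiso_map eG eH Phi).
Proof.
move=> _ _ _ _ _ _; split; first exact: qiso_map_of_alg_equiv.
by case=> Phi; exact: alg_equiv_of_qiso_map.
Qed.
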